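(* Consider the multi-agent system $\dot{x} = (I_N\otimes A)x + (I_N\otimes B)u$, $x(0)=x_0$, with agent state matrices $A\in\mathbb{R}^{n\times n}$, $B\in\mathbb{R}^{n\times m}$, where the pair $(A,B)$ is stabilizable, and with given real weighting matrices $Q\ge 0$ (size $n\times n$) and $R>0$ (size $m\times m$). Assume that the underlying graph on $N$ nodes is undirected and connected, with Laplacian $L$ having eigenvalues $0=\lambda_1<\lambda_2\le\cdots\le\lambda_N$. For $K\in\mathbb{R}^{m\times n}$ let $$J(K)=\int_0^\infty x^\top\left(L\otimes Q+L^2\otimes K^\top R K\right)x\,dt$$ be the cost along the solution of the controlled network $\dot{x}=(I_N\otimes A+L\otimes BK)x$, $x(0)=x_0$. Let a lower bound for $\lambda_2$ be given by $l_2>0$ and an upper bound for $\lambda_N$ be given by $L_N$ (so $0<l_2\le\lambda_2$ and $\lambda_N\le L_N$). Let $\gamma>0$. (a) Choose $c$ such that $$\frac{2}{l_2+L_N}\le c<\frac{2}{L_N}.$$ Define $K=-cR^{-1}B^\top P$ with $P\ge 0$ satisfying $$A^\top P+PA+(c^2L_N^2-2cL_N)PBR^{-1}B^\top P+L_N Q<0.$$ Then the controlled network reaches consensus, and the distributed control law $u=(L\otimes K)x$ is suboptimal, i.e. $J(K)<\gamma$, for all initial states $x_0$ that satisfy $$x_0^\top\left(\left(I_N-\frac1N\mathbf{1}_N\mathbf{1}_N^\top\right)\otimes P\right)x_0<\gamma,$$ equivalently $$\frac1N\sum_{i=1}^N\sum_{j>i}^N(x_{i0}-x_{j0})^\top P(x_{i0}-x_{j0})<\gamma.$$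 (b) Furthermore, if $c$ is chosen such that $$0<c<\frac{2}{l_2+L_N}$$ and $K=-cR^{-1}B^\top P$ is defined with $P\ge 0$ satisfying $$A^\top P+PA+(c^2l_2^2-2cl_2)PBR^{-1}B^\top P+L_N Q<0,$$ then, still, the controlled network reaches consensus and the distributed control law $u=(L\otimes K)x$ is suboptimal, i.e. $J(K)<\gamma$, for all $x_0$ that satisfy $$x_0^\top\left(\left(I_N-\frac1N\mathbf{1}_N\mathbf{1}_N^\top\right)\otimes P\right)x_0<\gamma,$$ equivalently $$\frac1N\sum_{i=1}^N\sum_{j>i}^N(x_{i0}-x_{j0})^\top P(x_{i0}-x_{j0})<\gamma.$$
   Context: Setting: there are $N\ge 2$ identical agents $\dot{x}_i=Ax_i+Bu_i$, $x_i(0)=x_{i0}$, $i=1,\dots,N$, with $x_i\in\mathbb{R}^n$, $u_i\in\mathbb{R}^m$; $x=(x_1^\top,\dots,x_N^\top)^\top\in\mathbb{R}^{nN}$, $u=(u_1^\top,\dots,u_N^\top)^\top\in\mathbb{R}^{mN}$, and $x_0=(x_{10}^\top,\dots,x_{N0}^\top)^\top$. A distributed control law is $u=(L\otimes K)x$ with a common gain $K\in\mathbb{R}^{m\times n}$; interconnecting it with the agents gives the controlled network $\dot{x}=(I_N\otimes A+L\otimes BK)x$. The pair $(A,B)$ is stabilizable if there is a real $F$ with $A+BF$ Hurwitz (all eigenvalues have negative real part). Consensus: the controlled network reaches consensus if for all $i,j=1,\dots,N$ and for all initial conditions on $x_i$ and $x_j$ one has $x_i(t)-x_j(t)\to 0$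 as $t\to\infty$. Notation: for a real symmetric matrix $P$, $P>0$ ($P\ge 0$) means positive definite (positive semi-definite), $P<0$ means $-P>0$; positive semi-definite matrices are real symmetric. $I_k$ is the $k\times k$ identity, $\mathbf{1}_N\in\mathbb{R}^N$ is the all-ones vector, $\otimes$ is the Kronecker product. The graph Laplacian is $L=D-\mathcal{A}$ with $\mathcal{A}$ the (0/1) adjacency matrix and $D$ the diagonal degree matrix. The scalar $L_N$ is not to be confused with the Laplacian matrix $L$. *)

(* Defs.v *)
(* MathComp-Analysis over an arbitrary [R : realType]; Kronecker products
   ([*t]) come from mathcomp-real-closed's mxtens and complex numbers ([R[i]])
   from its complex.  Vectors are columns ['cV[R]_n]. *)
From HB Require Import structures.
From mathcomp Require Import all_boot all_order all_algebra.
From mathcomp Require Import all_classical all_reals all_analysis.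
From mathcomp Require Import complex mxtens.
Set Implicit Arguments.
Unset Strict Implicit.
Unset Printing Implicit Defensive.
Import Order.TTheory GRing.Theory Num.Theory.
Import numFieldNormedType.Exports.
Local Open Scope classical_set_scope.
Local Open Scope ring_scope.

Definition quad_form (R : realType) (n : nat) (M : 'M[R]_n) (v : 'cV[R]_n) : R :=
  (v^T *m M *m v) 0 0.

Definition pos_semidef (R : realType) (n : nat) (M : 'M[R]_n) : Prop :=
  M \is symmetricmx /\ forall v : 'cV[R]_n, 0 <= quad_form M v.

Definition pos_def (R : realType) (n : nat) (M : 'M[R]_n) : Prop :=
  M \is symmetricmx /\ forall v : 'cV[R]_n, v != 0 -> 0 < quad_form M v.

Definition neg_def (R : realType) (n : nat) (M : 'M[R]_n) : Prop :=
  pos_def (- M).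

(* The eigenvalues of a real matrix are its complex ones. *)
Definition Hurwitz (R : realType) (n : nat) (M : 'M[R]_n) : Prop :=
  forall z : R[i],
    eigenvalue (map_mx (real_complex R) M) z -> complex.Re z < 0.

Definition stabilizable (R : realType) (n m : nat)
    (A : 'M[R]_n) (B : 'M[R]_(n, m)) : Prop :=
  exists F : 'M[R]_(m, n), Hurwitz (A + B *m F).

(* A simple undirected graph on the nodes ['I_N] is given by its adjacency
   relation. *)
Definition undirected_graph (N : nat) (e : rel 'I_N) : Prop :=
  symmetric e /\ irreflexive e.

Definition connected_graph (N : nat) (e : rel 'I_N) : Prop :=
  forall i j : 'I_N, connect e i j.

Definition adjacency (R : realType) (N : nat) (e : rel 'I_N) : 'M[R]_N :=
  \matrix_(i, j) (e i j)%:R.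

Definition degree_mx (R : realType) (N : nat) (e : rel 'I_N) : 'M[R]_N :=
  diag_mx (\row_i #|[set j | e i j]%SET|%:R).

Definition laplacian (R : realType) (N : nat) (e : rel 'I_N) : 'M[R]_N :=
  degree_mx R e - adjacency R e.

(* [lam] lists the eigenvalues of [M], with multiplicity, in nondecreasing
   order; the nth entry is counted from 0. *)
Definition ordered_eigenvalues (R : realType) (N : nat)
    (M : 'M[R]_N) (lam : N.-tuple R) : Prop :=
  char_poly M = \prod_(l <- lam) ('X - l%:P) /\ sorted <=%R lam.

(* The stacked state (x_1^T, ..., x_N^T)^T is indexed by ['I_(N * n)], where
   [mxtens_index (i, k)] has value [i * n + k]. *)
Definition agent_state (R : realType) (N n : nat)
    (x : 'cV[R]_(N * n)) (i : 'I_N) : 'cV[R]_n :=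
  \col_k x (mxtens_index (i, k)) 0.

(* x' = M x on [0, +oo[ with x(0) = x0: the values of [x] at negative times
   are irrelevant, and at 0 only continuity from the right is required (the
   right derivative at 0 then exists and equals [M *m x0]). *)
Definition is_solution (R : realType) (k : nat) (M : 'M[R]_k) (x0 : 'cV[R]_k)
    (x : R -> 'cV[R]_k) : Prop :=
  [/\ x 0 = x0,
      {within `[0, +oo[, continuous x} &
      forall t : R, 0 < t -> is_derive t 1 x (M *m x t)].

Definition controlled_network (R : realType) (N n m : nat) (e : rel 'I_N)
    (A : 'M[R]_n) (B : 'M[R]_(n, m)) (K : 'M[R]_(m, n)) : 'M[R]_(N * n) :=
  (1%:M : 'M[R]_N) *t A + laplacian R e *t (B *m K).

Definition reaches_consensus (R : realType) (N n m : nat) (e : rel 'I_N)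
    (A : 'M[R]_n) (B : 'M[R]_(n, m)) (K : 'M[R]_(m, n)) : Prop :=
  forall (x0 : 'cV[R]_(N * n)) (x : R -> 'cV[R]_(N * n)),
    is_solution (controlled_network e A B K) x0 x ->
    forall i j : 'I_N,
      agent_state (x t) i - agent_state (x t) j @[t --> +oo] --> (0 : 'cV[R]_n).

(* A Lebesgue integral in [\bar R]; for [Q] and [Rw] positive semidefinite the
   integrand is nonnegative and the value is +oo exactly when the improper
   integral diverges. *)
Definition cost (R : realType) (N n m : nat) (e : rel 'I_N)
    (Q : 'M[R]_n) (Rw : 'M[R]_m) (K : 'M[R]_(m, n))
    (x : R -> 'cV[R]_(N * n)) : \bar R :=
  (\int[lebesgue_measure]_(t in `[0%R, +oo[)
    (quad_form (laplacian R e *t Q +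
       (laplacian R e *m laplacian R e) *t (K^T *m Rw *m K)) (x t))%:E)%E.

(* J(K) < gamma, the cost being taken along the solution from [x0]. *)
Definition suboptimal (R : realType) (N n m : nat) (e : rel 'I_N)
    (A : 'M[R]_n) (B : 'M[R]_(n, m)) (Q : 'M[R]_n) (Rw : 'M[R]_m)
    (gamma : R) (K : 'M[R]_(m, n)) (x0 : 'cV[R]_(N * n)) : Prop :=
  forall x : R -> 'cV[R]_(N * n),
    is_solution (controlled_network e A B K) x0 x ->
    (cost e Q Rw K x < gamma%:E)%E.

(* x0^T ((I_N - 1/N 1_N 1_N^T) (x) P) x0 *)
Definition disagreement (R : realType) (N n : nat) (P : 'M[R]_n)
    (x0 : 'cV[R]_(N * n)) : R :=
  quad_form ((1%:M - N%:R^-1 *: ((const_mx 1 : 'cV[R]_N) *m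
                                 (const_mx 1 : 'cV[R]_N)^T)) *t P) x0.

Definition pairwise_disagreement (R : realType) (N n : nat) (P : 'M[R]_n)
    (x0 : 'cV[R]_(N * n)) : R :=
  N%:R^-1 * \sum_(i < N) \sum_(j < N | (i < j)%N)
    quad_form P (agent_state x0 i - agent_state x0 j).

(* A^T P + P A + (c^2 s^2 - 2 c s) P B R^-1 B^T P + LN Q *)
Definition riccati_expr (R : realType) (n m : nat)
    (A : 'M[R]_n) (B : 'M[R]_(n, m)) (Q : 'M[R]_n) (Rw : 'M[R]_m)
    (LN c s : R) (P : 'M[R]_n) : 'M[R]_n :=
  A^T *m P + P *m A
  + (c ^+ 2 * s ^+ 2 - 2 * c * s) *: (P *m B *m invmx Rw *m B^T *m P)
  + LN *: Q.

Definition gain (R : realType) (n m : nat)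
    (B : 'M[R]_(n, m)) (Rw : 'M[R]_m) (c : R) (P : 'M[R]_n) : 'M[R]_(m, n) :=
  - c *: (invmx Rw *m B^T *m P).

(* Main.v *)
Require Import Defs.
From HB Require Import structures.
From mathcomp Require Import all_boot all_order all_algebra.
From mathcomp Require Import all_classical all_reals all_analysis.
From mathcomp Require Import measurable_realfun complex mxtens ring.
Set Implicit Arguments.
Unset Strict Implicit.
Unset Printing Implicit Defensive.
Import Order.TTheory GRing.Theory Num.Theory.
Import numFieldNormedType.Exports.
Local Open Scope classical_set_scope.
Local Open Scope ring_scope.

(** Consensus and the cost bound both follow from one quadratic Lyapunov
function, the disagreement [V x = x^T (Pi *t P) x], where [Pi] is the
orthogonal projection onto the complement of the all-ones vector.

The Laplacian [L] is symmetric and its kernel consists of the constant vectors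
because the graph is connected.  Diagonalising it therefore yields eigenrows
[u_j] with eigenvalues [d_j] between the second and the last entry of the
spectrum such that [Pi], [L] and [L^2] are the sums of [u_j^T u_j] weighted by
[1], [d_j] and [d_j^2] ([laplacian_frame], [laplacian_frame_decomp]).  In the
modal coordinates [mode u_j x], which lie in the state space of one agent, the
network decouples: mode [j] evolves with the matrix [A + d_j B K]
([mode_controlled_network]), and [V], the running cost and the derivative of
[V] are sums over the modes ([bilin_tens_modes]).

For a single mode, the derivative of [V] plus the running cost is the value at
the mode of the Riccati expression written with [d_j] in place of both the
tuning value [s] and the bound [LN] ([closed_loop_riccati]).  Since
[d |-> c^2 d^2 - 2 c d] is a convex parabola, its maximum over the interval
[l2, LN] is at an endpoint: at [LN] when [2 / (l2 + LN) <= c] and at [l2] when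
[c <= 2 / (l2 + LN)].  This is where the two choices of [c] come from.  So the
expression for each mode, in which moreover [d_j *: Q <= LN *: Q], is bounded
by the one assumed to be negative definite ([riccati_le]), and summing over
the modes gives a constant [a > 0] with [V' + cost <= - a V] along every
solution ([disagreement_dissipation]).

The running cost is nonnegative, so [V] decays exponentially
([quad_form_solution_decay]).  The negative definite Riccati expression forces
[P] to be positive definite ([riccati_pos_def]), and [V] is a positive multiple
of the sum of the pairwise quantities [(x_i - x_j)^T P (x_i - x_j)]
([disagreementE]), so its decay is consensus.  Integrating [cost <= - V'] over
the half-line and using that [V] tends to [0] bounds the total cost by [V x0]
([integral_quad_form_le]), which is less than [gamma] by assumption. *)

(** * Symmetric matrices and frames of eigenvectors *)

Lemma symmetricmxP (R : realType) (n : nat) (M : 'M[R]_n) :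
  reflect (M^T = M) (M \is symmetricmx).
Proof.
have E : (-1) ^+ false *: map_mx idfun M^T = M^T.
  by rewrite expr0 scale1r; apply/matrixP => i j; rewrite !mxE.
by apply: (iffP (is_hermitianmxP false idfun M)); rewrite E => /esym.
Qed.

(** Stated with a Parseval frame rather than an orthonormal basis because this
is what the complex spectral theorem gives at once: a unitary eigenbasis over
[R[i]] has real eigenvalues, so the real and the imaginary parts of its rows
are again eigenrows, and taking real parts in [U^* U = 1] shows that they
resolve the identity.  Parts that vanish are dropped. *)
Lemma spectral_frame (R : realType) (n : nat) (M : 'M[R]_n) :
  M \is symmetricmx ->
  exists (I : finType) (d : I -> R) (u : I -> 'rV[R]_n),
    [/\ forall j, u j != 0,
        forall j, u j *m M = d j *: u j &
        \sum_j (u j)^T *m u j = 1%:M].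
Proof.
move=> Msym.
pose Mc := map_mx (real_complex R) M.
have ReD : {morph (@complex.Re R) : x y / x + y} by move=> [a b] [c d].
have ImD : {morph (@complex.Im R) : x y / x + y} by move=> [a b] [c d].
have ReMr (x : R[i]) (r : R) : complex.Re (x * r%:C)%C = complex.Re x * r.
  by case: x => a b /=; rewrite mulr0 subr0.
have ImMr (x : R[i]) (r : R) : complex.Im (x * r%:C)%C = complex.Im x * r.
  by case: x => a b /=; rewrite mulr0 add0r.
have Mherm : Mc \is hermsymmx.
  apply: realsym_hermsym; last first.
    by apply/mxOverP => i j; rewrite mxE; apply/complex_realP; exists (M i j).
  apply/is_hermitianmxP; rewrite expr0 scale1r.
  move/symmetricmxP: Msym => Msym; apply/matrixP => i j; rewrite !mxE /=.
  by rewrite -[in LHS]Msym mxE.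
have /orthomx_spectralP Mdec := hermitian_normalmx Mherm.
have Dreal := hermitian_spectral_diag_real Mherm.
have Uunit := spectral_unit Mc; have Uunitary := spectral_unitarymx Mc.
move: Mdec Dreal Uunit Uunitary.
set U := spectralmx Mc; set D := spectral_diag Mc => Mdec Dreal Uunit Uunitary.
have UM : U *m Mc = diag_mx D *m U by rewrite {1}Mdec -mulmxA mulKVmx.
have UU : invmx U *m U = 1%:M by rewrite mulVmx.
rewrite (invmx_unitary Uunitary) in UU.
(* The Boolean selects the real or the imaginary part of row [j.2] of [U]. *)
pose d0 (j : bool * 'I_n) := complex.Re (D 0 j.2).
pose u0 (j : bool * 'I_n) : 'rV[R]_n :=
  \row_k (if j.1 then complex.Re (U j.2 k) else complex.Im (U j.2 k)).
have Dd i : D 0 i = (complex.Re (D 0 i))%:C%C.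
  by rewrite RRe_real //; move/mxOverP: Dreal; apply.
have u0M j : u0 j *m M = d0 j *: u0 j.
  case: j => b i; apply/rowP => l; rewrite !mxE.
  move/matrixP/(_ i l): UM; rewrite mul_diag_mx !mxE Dd mulrC => UMil.
  case: b => /=.
    rewrite mulrC -ReMr -UMil (big_morph _ ReD (erefl (complex.Re 0))).
    by apply: eq_bigr => k _; rewrite !mxE ReMr.
  rewrite mulrC -ImMr -UMil (big_morph _ ImD (erefl (complex.Im 0))).
  by apply: eq_bigr => k _; rewrite !mxE ImMr.
have u0u0 : \sum_j (u0 j)^T *m u0 j = 1%:M.
  apply/matrixP => k l; rewrite summxE.
  transitivity (complex.Re ((1%:M : 'M[R[i]]_n) k l)); last first.
    by rewrite !mxE; case: eqP.
  rewrite -UU [in RHS]mxE (big_morph _ ReD (erefl (complex.Re 0))).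
  rewrite -(pair_big xpredT xpredT
              (fun b i => ((u0 (b, i))^T *m u0 (b, i)) k l)) /= big_bool /=.
  rewrite -big_split; apply: eq_bigr => i _ /=.
  rewrite !mxE !big_ord1 !mxE /=.
  by case: (U i k) (U i l) => [a b] [c e] /=; rewrite mulNr opprK.
exists {j : bool * 'I_n | u0 j != 0}, (fun j => d0 (val j)), (fun j => u0 (val j)).
split=> [[]//|j|]; first exact: u0M.
rewrite -(big_sub [pred j | u0 j != 0] (fun j => (u0 j)^T *m u0 j)).
rewrite -[RHS]u0u0 [RHS](bigID [pred j | u0 j != 0]) /=.
rewrite [X in _ = _ + X]big1 ?addr0 // => j /negPn/eqP ->.
by rewrite mulmx0.
Qed.

Lemma quad_formD (R : realType) (n : nat) (X Y : 'M[R]_n) (v : 'cV[R]_n) :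
  quad_form (X + Y) v = quad_form X v + quad_form Y v.
Proof. by rewrite /quad_form mulmxDr mulmxDl mxE. Qed.

Lemma quad_formZ (R : realType) (n : nat) (a : R) (X : 'M[R]_n) (v : 'cV[R]_n) :
  quad_form (a *: X) v = a * quad_form X v.
Proof. by rewrite /quad_form -scalemxAr -scalemxAl mxE. Qed.

Lemma quad_formN (R : realType) (n : nat) (X : 'M[R]_n) (v : 'cV[R]_n) :
  quad_form (- X) v = - quad_form X v.
Proof. by rewrite -scaleN1r quad_formZ mulN1r. Qed.

Lemma quad_form1 (R : realType) (n : nat) (v : 'cV[R]_n) :
  quad_form 1%:M v = \sum_i v i 0 ^+ 2.
Proof.
by rewrite /quad_form mulmx1 mxE; apply: eq_bigr => i _; rewrite mxE expr2.
Qed.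

Lemma quad_form1_eq0 (R : realType) (n : nat) (v : 'cV[R]_n) :
  (quad_form 1%:M v == 0) = (v == 0).
Proof.
rewrite quad_form1 psumr_eq0; last by move=> i _; apply: sqr_ge0.
apply/allP/eqP => [v0|-> i _]; last by rewrite mxE expr0n eqxx.
apply/colP => i; rewrite mxE; apply/eqP; rewrite -sqrf_eq0.
exact: (v0 i (mem_index_enum i)).
Qed.

Lemma frame_decomp (R : realType) (n : nat) (M : 'M[R]_n) (I : finType)
    (d : I -> R) (u : I -> 'rV[R]_n) :
  (forall j, u j *m M = d j *: u j) -> \sum_j (u j)^T *m u j = 1%:M ->
  M = \sum_j d j *: ((u j)^T *m u j).
Proof.
move=> uM uu; rewrite -[LHS]mul1mx -uu mulmx_suml.
by apply: eq_bigr => j _; rewrite -mulmxA uM scalemxAr.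
Qed.

Lemma quad_form_sum (R : realType) (n : nat) (I : finType)
    (d : I -> R) (u : I -> 'rV[R]_n) (v : 'cV[R]_n) :
  quad_form (\sum_j d j *: ((u j)^T *m u j)) v
  = \sum_j d j * ((u j *m v) 0 0) ^+ 2.
Proof.
rewrite /quad_form mulmx_sumr mulmx_suml summxE; apply: eq_bigr => j _.
rewrite -scalemxAr -scalemxAl mxE; congr (_ * _).
by rewrite mulmxA -(mulmxA _ (u j) v) -trmx_mul mxE big_ord1 mxE expr2.
Qed.

(** In a frame of eigenrows both forms are weighted sums of the same squares, so
it suffices to bound the finitely many weights below.  The inverse of
[1 + \sum_j d_j^-1] is a bound that avoids taking a minimum over a possibly
empty family. *)
Lemma coercive_of_eigenvalues_gt0 (R : realType) (n : nat) (M : 'M[R]_n) :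
  M \is symmetricmx ->
  (forall (a : R) (u : 'rV[R]_n), u != 0 -> u *m M = a *: u -> 0 < a) ->
  exists2 a : R, 0 < a & forall v, a * quad_form 1%:M v <= quad_form M v.
Proof.
move=> /spectral_frame [I [d [u [un0 uM uu]]]] Mgt0.
have d_gt0 j : 0 < d j := Mgt0 _ _ (un0 j) (uM j).
pose s := 1 + \sum_j (d j)^-1.
have s_gt0 : 0 < s.
  by rewrite ltr_pwDl// sumr_ge0// => j _; rewrite invr_ge0 ltW.
have sd j : s^-1 <= d j.
  rewrite -[d j]invrK lef_pV2 ?posrE ?invr_gt0//.
  rewrite /s (bigD1 j)//= addrCA lerDl addr_ge0//.
  by rewrite sumr_ge0// => k _; rewrite invr_ge0 ltW.
exists s^-1 => [|v]; first by rewrite invr_gt0.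
have -> : quad_form 1%:M v = quad_form (\sum_j 1 *: ((u j)^T *m u j)) v.
  by congr quad_form; rewrite -uu; apply: eq_bigr => j _; rewrite scale1r.
rewrite (frame_decomp uM uu) !quad_form_sum mulr_sumr.
by apply: ler_sum => j _; rewrite mul1r ler_wpM2r ?sqr_ge0.
Qed.

Lemma quad_form_le_norm (R : realType) (n : nat) (M : 'M[R]_n) :
  M \is symmetricmx ->
  exists2 a : R, 0 < a & forall v, quad_form M v <= a * quad_form 1%:M v.
Proof.
move=> /spectral_frame [I [d [u [_ uM uu]]]].
exists (1 + \sum_j `|d j|) => [|v]; first by rewrite ltr_pwDl// sumr_ge0.
have -> : quad_form 1%:M v = quad_form (\sum_j 1 *: ((u j)^T *m u j)) v.
  by congr quad_form; rewrite -uu; apply: eq_bigr => j _; rewrite scale1r.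
rewrite (frame_decomp uM uu) !quad_form_sum mulr_sumr.
apply: ler_sum => j _; rewrite mul1r ler_wpM2r ?sqr_ge0//.
rewrite (le_trans (ler_norm _))// (bigD1 j)//= addrCA lerDl addr_ge0//.
by rewrite sumr_ge0.
Qed.

Lemma quad_form_eigenrow (R : realType) (n : nat) (M : 'M[R]_n)
    (a : R) (u : 'rV[R]_n) :
  u *m M = a *: u -> quad_form M u^T = a * quad_form 1%:M u^T.
Proof.
by move=> uM; rewrite /quad_form trmxK uM mulmx1 -scalemxAl mxE.
Qed.

Lemma pos_def_coercive (R : realType) (n : nat) (M : 'M[R]_n) :
  pos_def M ->
  exists2 a : R, 0 < a & forall v, a * quad_form 1%:M v <= quad_form M v.
Proof.
move=> [Msym Mpos]; apply: coercive_of_eigenvalues_gt0 => // a u un0 uM.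
have utn0 : u^T != 0 by rewrite trmx_eq0.
have /Mpos := utn0; rewrite (quad_form_eigenrow uM) pmulr_lgt0//.
rewrite lt_neqAle eq_sym quad_form1_eq0 utn0 quad_form1.
by rewrite sumr_ge0// => i _; apply: sqr_ge0.
Qed.

(** * Spectrum of a graph Laplacian *)

(** A nonzero eigenvalue is a root of the characteristic polynomial, hence an
entry of [lam], and it is not the entry of index 0; the order of the list does
the rest. *)
Lemma nonzero_eigenvalue_bounds (R : realType) (N : nat) (M : 'M[R]_N)
    (lam : N.-tuple R) (a : R) (u : 'rV[R]_N) :
  ordered_eigenvalues M lam -> lam`_0 = 0 ->
  u != 0 -> u *m M = a *: u -> a != 0 -> lam`_1 <= a <= lam`_N.-1.
Proof.
move=> [charM lam_sorted] lam0 un0 uM an0.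
have a_lam : a \in lam.
  rewrite -root_prod_XsubC -charM -eigenvalue_root_char.
  by apply/eigenvalueP; exists u.
move: (a_lam); rewrite -index_mem size_tuple => ltaN.
have lam_a : lam`_(index a lam) = a by rewrite nth_index.
have ixgt0 : (0 < index a lam)%N.
  by rewrite lt0n; apply: contra_neq an0 => ix0; rewrite -lam_a ix0.
have le_nth i j : (i <= j)%N -> (j < N)%N -> lam`_i <= lam`_j.
  move=> leij ltjN; apply: (le_sorted_leq_nth _ lam_sorted); rewrite ?inE ?size_tuple//.
  exact: leq_ltn_trans ltjN.
have N_gt0 : (0 < N)%N := leq_ltn_trans (leq0n _) ltaN.
rewrite -lam_a; apply/andP; split; apply: le_nth => //.
  by rewrite -ltnS prednK.
by rewrite prednK.
Qed.

Lemma laplacian_mulE (R : realType) (N : nat) (e : rel 'I_N) (y : 'cV[R]_N)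
    (i : 'I_N) :
  (laplacian R e *m y) i 0 = \sum_j (e i j)%:R * (y i 0 - y j 0).
Proof.
rewrite mulmxBl mxE mul_diag_mx !mxE -sum1_card natr_sum mulr_suml.
rewrite big_mkcond /= -sumrB; apply: eq_bigr => j _.
by rewrite inE mxE mulrBr; case: (e i j); rewrite ?mul1r ?mul0r ?subr0.
Qed.

Lemma laplacian_symmetric (R : realType) (N : nat) (e : rel 'I_N) :
  undirected_graph e -> laplacian R e \is symmetricmx.
Proof.
move=> [esym _]; apply/symmetricmxP; rewrite linearB/= tr_diag_mx; congr (_ - _).
by apply/matrixP => i j; rewrite !mxE esym.
Qed.

Lemma laplacian_const1 (R : realType) (N : nat) (e : rel 'I_N) :
  laplacian R e *m const_mx 1 = 0 :> 'cV[R]_N.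
Proof.
apply/colP => i; rewrite laplacian_mulE [RHS]mxE big1// => j _.
by rewrite !mxE subrr mulr0.
Qed.

(** The form [y^T L y] is half the sum of the squares [(y_i - y_j)^2] over the
ordered pairs of neighbours.  If it vanishes, [y] takes equal values at
neighbours, hence along every path. *)
Lemma laplacian_ker_const (R : realType) (N : nat) (e : rel 'I_N)
    (y : 'cV[R]_N) :
  undirected_graph e -> connected_graph e -> laplacian R e *m y = 0 ->
  forall i j, y i 0 = y j 0.
Proof.
move=> [esym _] econn Ly.
pose E i j : R := (e i j)%:R * (y i 0 - y j 0) ^+ 2.
have E_ge0 i j : 0 <= E i j by rewrite mulr_ge0 ?sqr_ge0.
(* [H i j + H j i = E i j], and summing [H i j] over [j] gives [y_i (L y)_i]. *)
pose H i j : R := (e i j)%:R * (y i 0 * (y i 0 - y j 0)).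
have sumH : \sum_i \sum_j H i j = 0.
  rewrite big1// => i _; rewrite /H.
  under eq_bigr do rewrite mulrCA.
  by rewrite -mulr_sumr -laplacian_mulE Ly mxE mulr0.
have sumE : \sum_i \sum_j E i j = 0.
  have : \sum_i \sum_j H i j + \sum_i \sum_j H j i = 0.
    by rewrite [X in _ + X]exchange_big /= sumH addr0.
  rewrite -big_split /= => HH; rewrite -[RHS]HH; apply: eq_bigr => i _.
  rewrite -big_split; apply: eq_bigr => j _ /=.
  by rewrite /E /H (esym j i); ring.
have Eij i j : E i j = 0.
  have sum_ge0 k : true -> 0 <= \sum_j E k j by move=> _; apply: sumr_ge0.
  have Ei : \sum_j E i j = 0 by apply: (psumr_eq0P sum_ge0 sumE).
  by apply: (psumr_eq0P (fun j _ => E_ge0 i j) Ei).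
have step i j : e i j -> y i 0 = y j 0.
  move=> eij; have /eqP := Eij i j.
  by rewrite /E eij mul1r sqrf_eq0 subr_eq0 => /eqP.
move=> i j; have /connectP[p + ->] := econn i j.
by elim: p i => //= k p IH i /andP[/step -> /IH].
Qed.

(** The frame vectors of nonzero eigenvalue are kept.  Those of eigenvalue [0]
are constant, so they contribute a multiple of the all-ones matrix to the
resolution of the identity; evaluating at the all-ones vector, which is
orthogonal to the others, shows that the factor is [1 / N]. *)
Lemma laplacian_frame (R : realType) (N : nat) (e : rel 'I_N)
    (lam : N.-tuple R) :
  (0 < N)%N -> undirected_graph e -> connected_graph e ->
  ordered_eigenvalues (laplacian R e) lam -> lam`_0 = 0 ->
  exists (I : finType) (d : I -> R) (u : I -> 'rV[R]_N),
    [/\ forall j, lam`_1 <= d j <= lam`_N.-1,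
        forall j, u j *m laplacian R e = d j *: u j &
        1%:M - N%:R^-1 *: ((const_mx 1 : 'cV[R]_N) *m (const_mx 1 : 'cV[R]_N)^T)
        = \sum_j (u j)^T *m u j].
Proof.
move=> N_gt0 he econn hlam lam0.
have Lsym := laplacian_symmetric R he.
have [I [d [u [un0 uL uu]]]] := spectral_frame Lsym.
set one : 'cV[R]_N := const_mx 1.
pose nz := [pred j | d j != 0].
exists {j | j \in nz}, (fun j => d (val j)), (fun j => u (val j)).
split=> [[j djn0]|j|] /=.
- exact: nonzero_eigenvalue_bounds hlam lam0 (un0 j) (uL j) djn0.
- exact: uL.
rewrite -(big_sub nz (fun j => (u j)^T *m u j)).
apply/eqP; rewrite subr_eq -uu [X in X == _](bigID nz); apply/eqP; congr (_ + _).
set T := (LHS).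
pose i0 := Ordinal N_gt0.
have uconst j : ~~ nz j -> u j = u j 0 i0 *: one^T.
  move=> /negPn/eqP dj0.
  have Lu : laplacian R e *m (u j)^T = 0.
    have /symmetricmxP <- := Lsym.
    by rewrite -trmx_mul uL dj0 scale0r trmx0.
  apply/rowP => k; rewrite !mxE mulr1.
  by have := laplacian_ker_const he econn Lu k i0; rewrite !mxE.
pose a := \sum_(j | ~~ nz j) u j 0 i0 ^+ 2.
have TE : T = a *: (one *m one^T).
  rewrite /T /a scaler_suml; apply: eq_bigr => j /uconst ->.
  rewrite [(_ *: _)^T]linearZ /= trmxK -scalemxAl -scalemxAr scalerA.
  by rewrite !mxE mulr1 expr2.
have SE : 1%:M = \sum_(j | nz j) (u j)^T *m u j + T by rewrite -uu (bigID nz).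
have S1 : (\sum_(j | nz j) (u j)^T *m u j) *m one = 0.
  rewrite mulmx_suml big1// => j djn0; rewrite -mulmxA.
  have -> : u j *m one = 0; last by rewrite mulmx0.
  apply: (scalerI djn0); rewrite scalemxAl -uL -mulmxA laplacian_const1.
  by rewrite mulmx0 scaler0.
have T1 : T *m one = one by rewrite -[RHS]mul1mx SE mulmxDl S1 add0r.
rewrite TE; congr (_ *: _).
have /colP/(_ i0) := T1; rewrite TE -scalemxAl mxE -mulmxA.
rewrite [(one *m _) i0 0]mxE big_ord1 !mxE mul1r.
under eq_bigr do rewrite !mxE mulr1.
rewrite sumr_const card_ord => aN.
have Nn0 : N%:R != 0 :> R by rewrite pnatr_eq0 -lt0n.
by apply: (mulIf Nn0); rewrite aN mulVf.
Qed.

(** The all-ones vector is killed by [L], so the resolution of the projection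
that the frame provides may be multiplied by [L] as if it were a resolution of
the identity. *)
Lemma laplacian_frame_decomp (R : realType) (N : nat) (e : rel 'I_N)
    (I : finType) (d : I -> R) (u : I -> 'rV[R]_N) :
  undirected_graph e ->
  (forall j, u j *m laplacian R e = d j *: u j) ->
  1%:M - N%:R^-1 *: ((const_mx 1 : 'cV[R]_N) *m (const_mx 1 : 'cV[R]_N)^T)
    = \sum_j (u j)^T *m u j ->
  laplacian R e = \sum_j d j *: ((u j)^T *m u j) /\
  laplacian R e *m laplacian R e = \sum_j d j ^+ 2 *: ((u j)^T *m u j).
Proof.
move=> he uL uu.
have oneL : (const_mx 1 : 'cV[R]_N)^T *m laplacian R e = 0.
  have /symmetricmxP <- := laplacian_symmetric R he.
  by rewrite -trmx_mul laplacian_const1 trmx0.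
have LE : laplacian R e = \sum_j d j *: ((u j)^T *m u j).
  transitivity ((\sum_j (u j)^T *m u j) *m laplacian R e).
    by rewrite -uu mulmxBl mul1mx -scalemxAl -mulmxA oneL mulmx0 scaler0 subr0.
  by rewrite mulmx_suml; apply: eq_bigr => j _; rewrite -mulmxA uL scalemxAr.
split=> //; rewrite {1}LE mulmx_suml; apply: eq_bigr => j _.
by rewrite -scalemxAl -mulmxA uL -scalemxAr scalerA expr2.
Qed.

(** * Kronecker products and modal coordinates *)

Definition bilin (R : realType) (n : nat) (X : 'M[R]_n) (v w : 'cV[R]_n) : R :=
  (v^T *m X *m w) 0 0.

Lemma bilin_suml (R : realType) (n : nat) (X : 'M[R]_n) (I : finType)
    (a : I -> R) (v : I -> 'cV[R]_n) (w : 'cV[R]_n) :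
  bilin X (\sum_i a i *: v i) w = \sum_i a i * bilin X (v i) w.
Proof.
rewrite /bilin linear_sum /= !mulmx_suml summxE; apply: eq_bigr => i _.
by rewrite [(_ *: _)^T]linearZ /= -!scalemxAl mxE.
Qed.

Lemma bilin_sumr (R : realType) (n : nat) (X : 'M[R]_n) (I : finType)
    (a : I -> R) (v : 'cV[R]_n) (w : I -> 'cV[R]_n) :
  bilin X v (\sum_i a i *: w i) = \sum_i a i * bilin X v (w i).
Proof.
rewrite /bilin mulmx_sumr summxE; apply: eq_bigr => i _.
by rewrite -scalemxAr mxE.
Qed.

Lemma quad_formB_vec (R : realType) (n : nat) (X : 'M[R]_n) (v w : 'cV[R]_n) :
  quad_form X (v - w)
  = bilin X v v + bilin X w w - bilin X v w - bilin X w v.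
Proof.
rewrite /quad_form /bilin [(v - w)^T]linearB /= mulmxBr !mulmxBl !mxE; ring.
Qed.

Lemma sum_mxtens_index (R : realType) (N n : nat) (F : 'I_(N * n) -> R) :
  \sum_k F k = \sum_(i < N) \sum_(j < n) F (mxtens_index (i, j)).
Proof.
rewrite pair_big /= (reindex (@mxtens_index N n)) /=.
  by apply: eq_bigr => -[i j] _.
exists (@mxtens_unindex N n) => k _; [exact: mxtens_indexK|exact: mxtens_unindexK].
Qed.

Lemma bilin_tens (R : realType) (N n : nat) (U : 'M[R]_N) (W : 'M[R]_n)
    (x y : 'cV[R]_(N * n)) :
  bilin (U *t W) x y
  = \sum_i \sum_j U i j * bilin W (agent_state x i) (agent_state y j).
Proof.
rewrite /bilin -mulmxA mxE sum_mxtens_index; apply: eq_bigr => i _.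
transitivity (\sum_(k < n) \sum_(j < N) \sum_(l < n)
   x (mxtens_index (i, k)) 0 * (U i j * W k l * y (mxtens_index (j, l)) 0)).
  apply: eq_bigr => k _; rewrite !mxE sum_mxtens_index mulr_sumr.
  apply: eq_bigr => j _; rewrite mulr_sumr; apply: eq_bigr => l _.
  by rewrite tensmxE.
rewrite exchange_big; apply: eq_bigr => j _ /=.
rewrite -mulmxA mxE mulr_sumr; apply: eq_bigr => k _.
rewrite !mxE !mulr_sumr; apply: eq_bigr => l _; rewrite !mxE; ring.
Qed.

(** The product of the row [u *t I_n] and the stacked state; defined as a
combination of agent states so that the result has [n] rows and not
[1 * n]. *)
Definition mode (R : realType) (N n : nat) (u : 'rV[R]_N)
    (x : 'cV[R]_(N * n)) : 'cV[R]_n :=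
  \sum_i u 0 i *: agent_state x i.

(** The change to modal coordinates diagonalises the left factor of a Kronecker
product; the bilinear version is needed for the derivative of a quadratic form
along the flow, where the two arguments differ. *)
Lemma bilin_tens_modes (R : realType) (N n : nat) (I : finType) (a : I -> R)
    (u : I -> 'rV[R]_N) (W : 'M[R]_n) (x y : 'cV[R]_(N * n)) :
  bilin ((\sum_l a l *: ((u l)^T *m u l)) *t W) x y
  = \sum_l a l * bilin W (mode (u l) x) (mode (u l) y).
Proof.
rewrite bilin_tens.
transitivity (\sum_i \sum_j \sum_l a l * (u l 0 i * (u l 0 j *
   bilin W (agent_state x i) (agent_state y j)))).
  apply: eq_bigr => i _; apply: eq_bigr => j _.
  rewrite summxE mulr_suml; apply: eq_bigr => l _.
  by rewrite !mxE big_ord1 !mxE -!mulrA.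
under eq_bigr do rewrite exchange_big.
rewrite exchange_big; apply: eq_bigr => l _ /=.
rewrite bilin_suml mulr_sumr; apply: eq_bigr => i _.
by rewrite bilin_sumr !mulr_sumr.
Qed.

Lemma agent_state_tens (R : realType) (N n : nat) (U : 'M[R]_N) (W : 'M[R]_n)
    (x : 'cV[R]_(N * n)) (i : 'I_N) :
  agent_state (U *t W *m x) i = W *m \sum_j U i j *: agent_state x j.
Proof.
apply/colP => k; rewrite 2![LHS]mxE sum_mxtens_index mulmx_sumr summxE.
apply: eq_bigr => j _; rewrite -scalemxAr !mxE mulr_sumr.
by apply: eq_bigr => l _; rewrite tensmxE !mxE mulrA.
Qed.

Lemma mode_tens (R : realType) (N n : nat) (U : 'M[R]_N) (W : 'M[R]_n)
    (d : R) (u : 'rV[R]_N) (x : 'cV[R]_(N * n)) :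
  u *m U = d *: u -> mode u (U *t W *m x) = d *: (W *m mode u x).
Proof.
move=> uU; rewrite /mode.
under eq_bigr do rewrite agent_state_tens scalemxAr.
rewrite -mulmx_sumr scalemxAr; congr (_ *m _).
under eq_bigr do rewrite scaler_sumr.
rewrite exchange_big scaler_sumr; apply: eq_bigr => j _ /=.
under eq_bigr do rewrite scalerA.
by rewrite -scaler_suml scalerA; move/rowP/(_ j): uU; rewrite !mxE => ->.
Qed.

Lemma mode_controlled_network (R : realType) (N n m : nat) (e : rel 'I_N)
    (A : 'M[R]_n) (B : 'M[R]_(n, m)) (K : 'M[R]_(m, n)) (d : R) (u : 'rV[R]_N)
    (x : 'cV[R]_(N * n)) :
  u *m laplacian R e = d *: u ->
  mode u (controlled_network e A B K *m x)
  = (A + d *: (B *m K)) *m mode u x.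
Proof.
move=> uL; have u1 : u *m 1%:M = 1 *: u by rewrite mulmx1 scale1r.
transitivity (mode u (1%:M *t A *m x) + mode u (laplacian R e *t (B *m K) *m x)).
  rewrite /controlled_network mulmxDl /mode -big_split; apply: eq_bigr => i _ /=.
  by rewrite -scalerDr; congr (_ *: _); apply/colP => k; rewrite !mxE.
by rewrite (mode_tens _ _ u1) (mode_tens _ _ uL) scale1r mulmxDl scalemxAl.
Qed.

Lemma sum_lt_pairs (R : realType) (N : nat) (f : 'I_N -> 'I_N -> R) :
  (forall i j, f i j = f j i) -> (forall i, f i i = 0) ->
  \sum_i \sum_j f i j = (\sum_(i < N) \sum_(j < N | (i < j)%N) f i j) *+ 2.
Proof.
move=> fC f0.
transitivity (\sum_(i < N) (\sum_(j < N | (i < j)%N) f i j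
                      + \sum_(j < N | (j < i)%N) f i j)).
  apply: eq_bigr => i _; rewrite [LHS](bigD1 i)//= f0 add0r.
  rewrite (bigID (fun j : 'I_N => (i < j)%N)) /=; congr (_ + _).
    by apply: eq_bigl => j; rewrite -val_eqE /= neq_ltn; case: ltngtP.
  by apply: eq_bigl => j; rewrite -val_eqE /= neq_ltn; case: ltngtP.
rewrite big_split mulr2n /=; congr (_ + _).
rewrite (exchange_big_dep xpredT) //=; apply: eq_bigr => i _.
by apply: eq_bigr => j _; rewrite fC.
Qed.

(** Both sides expand to the sum of the [x_i^T P x_i] minus [1 / N] times the
sum of all the [x_i^T P x_j]. *)
Lemma disagreementE (R : realType) (N n : nat) (P : 'M[R]_n)
    (x : 'cV[R]_(N * n)) :
  (0 < N)%N -> disagreement P x = pairwise_disagreement P x.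
Proof.
move=> N_gt0; have Nn0 : N%:R != 0 :> R by rewrite pnatr_eq0 -lt0n.
pose b i j := bilin P (agent_state x i) (agent_state x j).
have dE : disagreement P x = \sum_i b i i - N%:R^-1 * \sum_i \sum_j b i j.
  transitivity (bilin ((1%:M - N%:R^-1 *: ((const_mx 1 : 'cV[R]_N) *m
                                 (const_mx 1 : 'cV[R]_N)^T)) *t P) x x) => //.
  rewrite bilin_tens mulr_sumr -sumrB; apply: eq_bigr => i _.
  rewrite mulr_sumr.
  transitivity (\sum_j ((i == j)%:R * b i j - N%:R^-1 * b i j)).
    by apply: eq_bigr => j _; rewrite !mxE big_ord1 !mxE !mulr1 mulrBl.
  rewrite sumrB (bigD1 i)//= eqxx mul1r big1 ?addr0// => j.
  by rewrite eq_sym => /negbTE ->; rewrite mul0r.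
have fE : \sum_i \sum_j quad_form P (agent_state x i - agent_state x j)
          = (N%:R * \sum_i b i i - \sum_i \sum_j b i j) *+ 2.
  transitivity (\sum_i \sum_j (b i i + b j j - b i j - b j i)).
    by apply: eq_bigr => i _; apply: eq_bigr => j _; apply: quad_formB_vec.
  under eq_bigr do rewrite !sumrB big_split /= sumr_const card_ord.
  rewrite !sumrB big_split /= sumr_const card_ord.
  rewrite [X in _ - X]exchange_big /= sumrMnl.
  move: (\sum_(i < N) b i i) (\sum_(i < N) \sum_(j < N) b i j) => S T.
  rewrite -!(mulr_natl S) mulr2n; move: (N%:R * S) => NS.
  by rewrite addrACA addrA.
move: fE; rewrite sum_lt_pairs; last 2 first.
- by move=> i j; rewrite !quad_formB_vec; ring.
- by move=> i; rewrite quad_formB_vec; ring.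
move=> /(@pmulrnI R 2 isT) fE.
by rewrite /pairwise_disagreement fE dE mulrBr mulrA mulVf// mul1r.
Qed.

(** * Riccati inequalities for the closed-loop modes *)

Lemma quad_form_lyapunov (R : realType) (n : nat) (M X : 'M[R]_n)
    (v : 'cV[R]_n) :
  quad_form (M^T *m X + X *m M) v = bilin X (M *m v) v + bilin X v (M *m v).
Proof. by rewrite quad_formD /quad_form /bilin trmx_mul !mulmxA. Qed.

Lemma pos_def_unitmx (R : realType) (n : nat) (M : 'M[R]_n) :
  pos_def M -> M \in unitmx.
Proof.
move=> [_ Mpos]; rewrite -row_free_unit; apply: inj_row_free => u uM0.
apply/eqP; apply: contraT => un0.
have /Mpos : u^T != 0 by rewrite trmx_eq0.
by rewrite /quad_form trmxK uM0 mul0mx mxE ltxx.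
Qed.

Lemma pos_def_semidef (R : realType) (n : nat) (M : 'M[R]_n) :
  pos_def M -> pos_semidef M.
Proof.
move=> [Msym Mpos]; split=> // v; have [->|/Mpos/ltW//] := eqVneq v 0.
by rewrite /quad_form mulmx0 mxE.
Qed.

Lemma quad_form_congr_ge0 (R : realType) (n m : nat) (M : 'M[R]_m)
    (G : 'M[R]_(m, n)) (v : 'cV[R]_n) :
  pos_semidef M -> 0 <= quad_form (G^T *m M *m G) v.
Proof.
by move=> [_ /(_ (G *m v))]; rewrite /quad_form trmx_mul !mulmxA.
Qed.

(** The congruence of [Rw] on the right makes visible that the quadratic term of
the Riccati expression is symmetric and positive semidefinite, and that it is
the control cost up to the factor [c ^+ 2]. *)
Lemma control_cost_matrix (R : realType) (n m : nat) (B : 'M[R]_(n, m))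
    (Rw : 'M[R]_m) (P : 'M[R]_n) :
  pos_def Rw -> P \is symmetricmx ->
  P *m B *m invmx Rw *m B^T *m P
  = (invmx Rw *m B^T *m P)^T *m Rw *m (invmx Rw *m B^T *m P).
Proof.
move=> Rpos /symmetricmxP Psym; have Runit := pos_def_unitmx Rpos.
case: Rpos => /symmetricmxP Rsym _.
by rewrite !trmx_mul trmxK Psym trmx_inv Rsym !mulmxA mulmxKV.
Qed.

(** Each of [F^T P] and [P F] contributes [- c d] times the quadratic term, and
the control cost contributes [c^2 d^2] times it: the closed loop reproduces the
Riccati expression exactly, with the eigenvalue [d] in both free slots. *)
Lemma closed_loop_riccati (R : realType) (n m : nat)
    (A : 'M[R]_n) (B : 'M[R]_(n, m)) (Q : 'M[R]_n) (Rw : 'M[R]_m)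
    (c d : R) (P : 'M[R]_n) (K := gain B Rw c P)
    (F := A + d *: (B *m K)) :
  pos_def Rw -> P \is symmetricmx ->
  F^T *m P + P *m F + (d *: Q + d ^+ 2 *: (K^T *m Rw *m K))
  = riccati_expr A B Q Rw d c d P.
Proof.
move=> Rpos Psym; have SE := control_cost_matrix B Rpos Psym.
rewrite /riccati_expr; set S := P *m B *m invmx Rw *m B^T *m P in SE *.
have /symmetricmxP PT := Psym.
have PBK : P *m (B *m K) = - c *: S.
  by rewrite /K /gain -!scalemxAr /S !mulmxA.
have BKP : (B *m K)^T *m P = - c *: S.
  rewrite -[in LHS]PT -trmx_mul PBK linearZ /=; congr (_ *: _).
  rewrite SE !trmx_mul !trmxK mulmxA; congr (_ *m _ *m _).
  by case: Rpos => /symmetricmxP.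
have KRK : K^T *m Rw *m K = c ^+ 2 *: S.
  rewrite SE /K /gain [(_ *: _)^T]linearZ /= -!scalemxAl -scalemxAr scalerA.
  by rewrite mulrNN -expr2.
rewrite /F linearD /= [(_ *: _)^T]linearZ /= mulmxDl mulmxDr.
rewrite -(scalemxAl d) -(scalemxAr d).
rewrite PBK BKP KRK; move: (A^T *m P) (P *m A) (S) => X Y Z.
by apply/matrixP => i j; rewrite !mxE; ring.
Qed.

Lemma riccati_le (R : realType) (n m : nat)
    (A : 'M[R]_n) (B : 'M[R]_(n, m)) (Q : 'M[R]_n) (Rw : 'M[R]_m)
    (c s d q : R) (P : 'M[R]_n) (v : 'cV[R]_n) :
  pos_semidef Q -> pos_def Rw -> P \is symmetricmx ->
  c ^+ 2 * d ^+ 2 - 2 * c * d <= c ^+ 2 * s ^+ 2 - 2 * c * s -> d <= q ->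
  quad_form (riccati_expr A B Q Rw d c d P) v
  <= quad_form (riccati_expr A B Q Rw q c s P) v.
Proof.
move=> [_ Qpos] Rpos Psym le_cds le_dq.
rewrite !(quad_formD, quad_formZ) lerD ?ler_wpM2r// lerD2l ler_wpM2r//.
rewrite (control_cost_matrix B Rpos Psym).
exact/quad_form_congr_ge0/pos_def_semidef.
Qed.

(** On a kernel vector of [P] every term of the Riccati expression vanishes
except the one in [Q], which is nonnegative; negative definiteness thus
excludes the eigenvalue [0]. *)
Lemma riccati_pos_def (R : realType) (n m : nat)
    (A : 'M[R]_n) (B : 'M[R]_(n, m)) (Q : 'M[R]_n) (Rw : 'M[R]_m)
    (LN c s : R) (P : 'M[R]_n) :
  pos_semidef Q -> 0 <= LN -> pos_semidef P ->
  neg_def (riccati_expr A B Q Rw LN c s P) ->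
  exists2 a : R, 0 < a & forall v, a * quad_form 1%:M v <= quad_form P v.
Proof.
move=> [_ Qpos] LN_ge0 [Psym Ppos] [_ Mneg].
apply: coercive_of_eigenvalues_gt0 => // a u un0 uP.
have utn0 : u^T != 0 by rewrite trmx_eq0.
have unorm : 0 < quad_form 1%:M u^T.
  rewrite lt_neqAle eq_sym quad_form1_eq0 utn0 quad_form1.
  by rewrite sumr_ge0// => i _; apply: sqr_ge0.
have a_ge0 : 0 <= a.
  by rewrite -(pmulr_lge0 _ unorm) -(quad_form_eigenrow uP) Ppos.
rewrite lt_neqAle a_ge0 andbT eq_sym; apply: contraT => /negPn/eqP a0.
have uP0 : u *m P = 0 by rewrite uP a0 scale0r.
have Pu0 : P *m u^T = 0.
  by have /symmetricmxP <- := Psym; rewrite -trmx_mul uP0 trmx0.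
have /Mneg := utn0; rewrite quad_formN oppr_gt0 ltNge.
rewrite /riccati_expr !(quad_formD, quad_formZ) /quad_form trmxK.
rewrite !mulmxA uP0 !mul0mx -!mulmxA Pu0 !mulmx0 !mxE !mulr0 !add0r.
rewrite mulr_ge0//; have := Qpos u^T.
by rewrite /quad_form trmxK -mulmxA mxE.
Qed.

(** * Quadratic forms along solutions of linear differential equations *)

Lemma bilinE (R : realType) (n : nat) (X : 'M[R]_n) (v w : 'cV[R]_n) :
  bilin X v w = \sum_i \sum_j X i j * (v i 0 * w j 0).
Proof.
rewrite /bilin -mulmxA mxE; apply: eq_bigr => i _; rewrite !mxE mulr_sumr.
by apply: eq_bigr => j _; ring.
Qed.

Lemma quad_form_continuous (R : realType) (n : nat) (X : 'M[R]_n) :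
  continuous (quad_form X).
Proof.
have cc i : continuous (fun w : 'cV[R]_n => w i 0).
  exact: coord_continuous.
have cij i j : continuous (fun w : 'cV[R]_n => X i j * (w i 0 * w j 0)).
  move=> v.
  exact: (cvgMl_tmp (cvgM (cc i v) (cc j v))).
have -> : quad_form X = fun v => \sum_i \sum_j X i j * (v i 0 * v j 0).
  by apply/funext => v; rewrite -bilinE.
apply: (continuous_big add_continuous) => i _.
by apply: (continuous_big add_continuous) => j _; apply: cij.
Qed.

Lemma quad_form_solution_continuous (R : realType) (n : nat) (M X : 'M[R]_n)
    (x0 : 'cV[R]_n) (x : R -> 'cV[R]_n) :
  is_solution M x0 x ->
  {within `[0, +oo[, continuous (fun t => quad_form X (x t))}.
Proof.
move=> [_ xc _] t.
apply: (@continuous_comp _ _ _ (from_subspace _ x) (quad_form X)).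
  exact: xc.
exact: quad_form_continuous.
Qed.

Lemma quad_form_solution_derive (R : realType) (n : nat) (M X : 'M[R]_n)
    (x0 : 'cV[R]_n) (x : R -> 'cV[R]_n) (t : R) :
  is_solution M x0 x -> 0 < t ->
  is_derive t 1 (fun s => quad_form X (x s))
    (quad_form (M^T *m X + X *m M) (x t)).
Proof.
move=> [_ _ xd] t_gt0; have [xdv xD] := xd t t_gt0.
have dx i : is_derive t 1 (fun s => x s i 0) ((M *m x t) i 0).
  split; first by move/derivable_mxP : xdv.
  by rewrite -xD derive_mx// mxE.
have -> : (fun s => quad_form X (x s))
    = \sum_i \sum_j (fun s => X i j * (x s i 0 * x s j 0)).
  apply/funext => s; rewrite fct_sumE.
  transitivity (bilin X (x s) (x s)) => //; rewrite bilinE.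
  by apply: eq_bigr => i _; rewrite fct_sumE.
rewrite quad_form_lyapunov !bilinE -big_split /=.
apply: is_derive_sum => i; rewrite -big_split /=.
apply: is_derive_sum => j.
apply: is_derive_eq.
by rewrite /GRing.scale /=; ring.
Qed.

(** The function [expR (a * t) * quad_form X (x t)] has a nonpositive derivative
for positive [t], so the form is at most its initial value times
[expR (- (a * t))]. *)
Lemma quad_form_solution_decay (R : realType) (n : nat) (M X : 'M[R]_n)
    (a : R) (x0 : 'cV[R]_n) (x : R -> 'cV[R]_n) :
  0 < a -> (forall v, 0 <= quad_form X v) ->
  (forall v, quad_form (M^T *m X + X *m M) v <= - a * quad_form X v) ->
  is_solution M x0 x ->
  quad_form X (x t) @[t --> +oo] --> (0 : R).
Proof.
move=> a_gt0 X_ge0 decr xsol.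
pose f t := expR (a * t) * quad_form X (x t).
pose f' t := expR (a * t) * (a * quad_form X (x t)
                             + quad_form (M^T *m X + X *m M) (x t)).
have df (t : R) : 0 < t -> is_derive t 1 f (f' t).
  move=> t_gt0; have dX := quad_form_solution_derive X xsol t_gt0.
  have dE : is_derive t 1 (fun s => expR (a * s)) (a * expR (a * t)).
    by apply: is_derive_eq; rewrite /GRing.scale /=; ring.
  apply: is_derive_eq; rewrite /f' /GRing.scale /=; ring.
have f_le (t : R) : 0 <= t -> f t <= f 0.
  move=> t_ge0; apply: (@ler0_derive1_nincry R f 0) => //.
  - by move=> s; rewrite in_itv /= andbT => /df[].
  - move=> s; rewrite in_itv /= andbT => s_gt0; have [_ fD] := df s s_gt0.
    rewrite derive1E fD mulr_ge0_le0 ?expR_ge0//.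
    by rewrite -[a * _]opprK addrC subr_le0 -mulNr; apply: decr.
  move=> s; apply: (@continuousM R _ (from_subspace _ (fun s => expR (a * s)))
                      (from_subspace _ (fun s => quad_form X (x s)))).
    apply: (@continuous_subspaceT _ _ _ (fun s => expR (a * s))) => r.
    apply: (@continuous_comp _ _ _ ( *%R a) expR); first exact: mulrl_continuous.
    exact: continuous_expR.
  exact: (quad_form_solution_continuous xsol).
have bound (t : R) : 0 <= t -> quad_form X (x t) <= quad_form X (x 0) * expR (- (a * t)).
  move=> /f_le; rewrite /f mulr0 expR0 mul1r => le_t.
  by rewrite expRN ler_pdivlMr ?expR_gt0// mulrC.
apply: (@squeeze_cvgr _ _ _ _ (fun=> 0)
  (fun t => quad_form X (x 0) * expR (- (a * t)))).
- near=> t; rewrite X_ge0 bound//; near: t; exact: nbhs_pinfty_ge.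
- exact: cvg_cst.
- have at_y : a * t @[t --> +oo] --> +oo by exact: (gt0_cvgMry a_gt0 cvg_id).
  have e0 : expR (- (a * t)) @[t --> +oo] --> (0 : R).
    exact: (cvg_comp _ _ at_y (@cvgr_expR R)).
  have H := cvgM (cvg_cst (quad_form X (x 0))) e0.
  rewrite mulr0 in H.
  exact: H.
Unshelve. all: by end_near. Qed.

(** By the fundamental theorem of calculus the integral of minus the derivative
of the form over the half-line is the initial value of the form, because the
form tends to [0]. *)
Lemma integral_quad_form_le (R : realType) (n : nat) (M X C : 'M[R]_n)
    (x0 : 'cV[R]_n) (x : R -> 'cV[R]_n) :
  (forall v, 0 <= quad_form C v <= - quad_form (M^T *m X + X *m M) v) ->
  is_solution M x0 x ->
  quad_form X (x t) @[t --> +oo] --> (0 : R) ->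
  (\int[lebesgue_measure]_(t in `[0%R, +oo[) (quad_form C (x t))%:E
   <= (quad_form X x0)%:E)%E.
Proof.
move=> C_bound xsol Xto0; have [x_at0 _ _] := xsol.
pose Y := M^T *m X + X *m M.
have mquad (Z : 'M[R]_n) :
    measurable_fun (`[0, +oo[ : set R) (fun t : R => quad_form Z (x t)).
  apply: subspace_continuous_measurable_fun => //.
  exact: quad_form_solution_continuous xsol.
have XE : (\int[lebesgue_measure]_(t in `[0%R, +oo[) (quad_form (- Y) (x t))%:E
           = (quad_form X x0)%:E)%E.
  rewrite (@ge0_continuous_FTC2y _ _ (fun t => quad_form (- X) (x t)) 0 0).
  - by rewrite -EFinB sub0r quad_formN opprK x_at0.
  - by move=> t _; rewrite quad_formN; case/andP: (C_bound (x t)) => /le_trans; apply.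
  - exact: quad_form_solution_continuous xsol.
  - under eq_fun do rewrite quad_formN; rewrite -oppr0; exact: cvgN.
  - by move=> t /(quad_form_solution_derive (- X) xsol)[].
  - have := quad_form_solution_continuous (X := - X) xsol.
    by move=> /continuous_within_itvcyP[].
  - move=> t; rewrite in_itv /= andbT.
    move=> /(quad_form_solution_derive (- X) xsol)[_ XD].
    by rewrite derive1E XD mulmxN mulNmx -opprD.
rewrite -XE; apply: ge0_le_integral => //.
- by move=> t _; rewrite lee_fin; case/andP: (C_bound (x t)).
- by apply/measurable_EFinP; apply: mquad.
- by apply/measurable_EFinP; apply: mquad.
- by move=> t _; rewrite lee_fin quad_formN; case/andP: (C_bound (x t)).
Qed.

(** * Consensus and suboptimality *)

(** All three forms are sums over the modes, so the inequality is proved mode by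
mode; the rate [a / b] compares a coercivity constant [a] of the negated
Riccati expression with an upper bound [b] for [P]. *)
Lemma disagreement_dissipation (R : realType) (N n m : nat)
    (A : 'M[R]_n) (B : 'M[R]_(n, m)) (Q : 'M[R]_n) (Rw : 'M[R]_m)
    (e : rel 'I_N) (lam : N.-tuple R) (LN c s : R) (P : 'M[R]_n)
    (K := gain B Rw c P) (M := controlled_network e A B K)
    (X := (1%:M - N%:R^-1 *: ((const_mx 1 : 'cV[R]_N) *m
                                 (const_mx 1 : 'cV[R]_N)^T)) *t P)
    (C := laplacian R e *t Q +
          (laplacian R e *m laplacian R e) *t (K^T *m Rw *m K)) :
  (0 < N)%N -> pos_semidef Q -> pos_def Rw -> undirected_graph e ->
  connected_graph e ->
  ordered_eigenvalues (laplacian R e) lam -> lam`_0 = 0 -> 0 < lam`_1 ->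
  lam`_N.-1 <= LN ->
  (forall d, lam`_1 <= d <= lam`_N.-1 ->
     c ^+ 2 * d ^+ 2 - 2 * c * d <= c ^+ 2 * s ^+ 2 - 2 * c * s) ->
  pos_semidef P -> neg_def (riccati_expr A B Q Rw LN c s P) ->
  exists2 a : R, 0 < a & forall y,
    [/\ 0 <= quad_form X y, 0 <= quad_form C y &
        quad_form (M^T *m X + X *m M) y + quad_form C y
        <= - a * quad_form X y].
Proof.
move=> N_gt0 Qpos Rpos he hconn hlam lam0 lam1 hLN hc [Psym Ppos] Mneg.
have [I [d [u [dB uL uu]]]] := laplacian_frame N_gt0 he hconn hlam lam0.
have [LE L2E] := laplacian_frame_decomp he uL uu.
have d_ge0 j : 0 <= d j.
  by have /andP[+ _] := dB j; apply: le_trans; apply: ltW.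
have XE v w : bilin X v w = \sum_j bilin P (mode (u j) v) (mode (u j) w).
  rewrite /X uu; under eq_bigr do rewrite -[_ *m _]scale1r.
  by rewrite bilin_tens_modes; apply: eq_bigr => j _; rewrite mul1r.
pose D j := d j *: Q + d j ^+ 2 *: (K^T *m Rw *m K).
have CE v : quad_form C v = \sum_j quad_form (D j) (mode (u j) v).
  rewrite quad_formD {1}LE L2E.
  rewrite -[X in X + _ = _]/(bilin _ v v) -[X in _ + X = _]/(bilin _ v v).
  rewrite !bilin_tens_modes -big_split; apply: eq_bigr => j _ /=.
  by rewrite quad_formD !quad_formZ.
pose F j := A + d j *: (B *m K).
have ME v : quad_form (M^T *m X + X *m M) v
    = \sum_j quad_form ((F j)^T *m P + P *m F j) (mode (u j) v).
  rewrite quad_form_lyapunov !XE -big_split; apply: eq_bigr => j _ /=.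
  by rewrite quad_form_lyapunov /M (mode_controlled_network _ _ _ _ (uL j)).
have [a a_gt0 aM] := pos_def_coercive Mneg.
have [b b_gt0 bP] := quad_form_le_norm Psym.
exists (a / b) => [|y]; first by rewrite divr_gt0.
split.
- by rewrite -[quad_form X y]/(bilin X y y) XE sumr_ge0// => j _; apply: Ppos.
- rewrite CE sumr_ge0// => j _; rewrite quad_formD !quad_formZ addr_ge0//.
    by rewrite mulr_ge0// (Qpos.2).
  by rewrite mulr_ge0 ?sqr_ge0// quad_form_congr_ge0//; apply: pos_def_semidef.
rewrite -[quad_form X y]/(bilin X y y) XE ME CE -big_split mulr_sumr.
apply: ler_sum => j _ /=; rewrite -quad_formD closed_loop_riccati//.
have dLN : d j <= LN by have /andP[_ /le_trans] := dB j; apply.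
apply: le_trans (riccati_le _ _ _ Qpos Rpos Psym (hc _ (dB j)) dLN) _.
have := aM (mode (u j) y); rewrite quad_formN => aMj.
rewrite -[leLHS]opprK mulNr lerN2; apply: le_trans aMj.
by rewrite mulrAC ler_pdivrMr// -mulrA ler_wpM2l ?(ltW a_gt0)// mulrC; apply: bP.
Qed.

(** Each squared entry of [x_i - x_j] is at most [N / b] times the disagreement,
which is [1 / N] times a sum over pairs of nonnegative terms, each at least
[b] times a squared distance. *)
Lemma consensus_of_disagreement_cvg (R : realType) (N n : nat) (P : 'M[R]_n)
    (x : R -> 'cV[R]_(N * n)) (b : R) :
  (0 < N)%N -> 0 < b -> (forall v, b * quad_form 1%:M v <= quad_form P v) ->
  disagreement P (x t) @[t --> +oo] --> (0 : R) ->
  forall i j : 'I_N,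
    agent_state (x t) i - agent_state (x t) j @[t --> +oo] --> (0 : 'cV[R]_n).
Proof.
move=> N_gt0 b_gt0 bP xto0 i j.
(* [pairwise_disagreement] counts each unordered pair once, as [i < j]. *)
wlog lt_ij : i j / (i < j)%N => [ih|].
  have [/ih//|lt_ji|/val_inj ->] := ltngtP i j.
    under eq_fun do rewrite -opprB.
    by rewrite -oppr0; apply: cvgN; apply: ih.
  under eq_fun do rewrite subrr.
  exact: cvg_cst.
have NR_gt0 : 0 < N%:R :> R by rewrite ltr0n.
have P_ge0 v : 0 <= quad_form P v.
  apply: le_trans (bP v); rewrite mulr_ge0 ?(ltW b_gt0)// quad_form1.
  by rewrite sumr_ge0// => k _; apply: sqr_ge0.
have entry_le t k :
    (agent_state (x t) i - agent_state (x t) j) k 0 ^+ 2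
    <= N%:R / b * disagreement P (x t).
  set v := agent_state _ _ - _; rewrite disagreementE// /pairwise_disagreement.
  rewrite [N%:R / b]mulrC -mulrA mulVKf ?lt0r_neq0// ler_pdivlMl//.
  apply: (@le_trans _ _ (quad_form P v)).
    apply: le_trans (bP v); rewrite ler_pM2l// quad_form1 (bigD1 k)//=.
    by rewrite lerDl sumr_ge0// => l _; apply: sqr_ge0.
  rewrite (bigD1 i)//= (bigD1 j)//= -addrA lerDl addr_ge0// sumr_ge0// => p _.
  by rewrite sumr_ge0.
apply/cvgrPdist_le => eps eps_gt0.
have del_gt0 : 0 < b / N%:R * eps ^+ 2 by rewrite mulr_gt0 ?divr_gt0 ?exprn_gt0.
move/cvgrPdist_le : xto0 => /(_ _ del_gt0); apply: filterS => t.
rewrite !sub0r !normrN => Vt.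
rewrite [leLHS]/Num.Def.normr/= mx_normrE (bigmax_le _ (ltW eps_gt0))//=.
move=> [k l] _; rewrite ord1 -(@ler_pXn2r _ 2) ?nnegrE ?(ltW eps_gt0)//.
rewrite real_normK ?num_real//; apply: le_trans (entry_le t k) _.
rewrite mulrC -ler_pdivlMr ?divr_gt0// invf_div mulrC.
exact: le_trans (ler_norm _) Vt.
Qed.

(** The common core of both design rules: they differ only in the point [s] at
which the parabola is required to dominate its values on the nonzero
spectrum. *)
Lemma consensus_and_suboptimal (R : realType) (N n m : nat)
    (A : 'M[R]_n) (B : 'M[R]_(n, m)) (Q : 'M[R]_n) (Rw : 'M[R]_m)
    (e : rel 'I_N) (lam : N.-tuple R) (LN c s gamma : R) (P : 'M[R]_n) :
  (0 < N)%N -> pos_semidef Q -> pos_def Rw -> undirected_graph e ->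
  connected_graph e ->
  ordered_eigenvalues (laplacian R e) lam -> lam`_0 = 0 -> 0 < lam`_1 ->
  0 <= LN -> lam`_N.-1 <= LN ->
  (forall d, lam`_1 <= d <= lam`_N.-1 ->
     c ^+ 2 * d ^+ 2 - 2 * c * d <= c ^+ 2 * s ^+ 2 - 2 * c * s) ->
  pos_semidef P -> neg_def (riccati_expr A B Q Rw LN c s P) ->
  reaches_consensus e A B (gain B Rw c P) /\
  forall x0 : 'cV[R]_(N * n),
    (disagreement P x0 < gamma <-> pairwise_disagreement P x0 < gamma) /\
    (disagreement P x0 < gamma ->
     suboptimal e A B Q Rw gamma (gain B Rw c P) x0).
Proof.
move=> N_gt0 Qpos Rpos he hconn hlam lam0 lam1 LN_ge0 hLN hc Ppos Mneg.
have [b b_gt0 bP] := riccati_pos_def Qpos LN_ge0 Ppos Mneg.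
have [a a_gt0 dissip] :=
  disagreement_dissipation N_gt0 Qpos Rpos he hconn hlam lam0 lam1 hLN hc Ppos Mneg.
have decay x0 x : is_solution (controlled_network e A B (gain B Rw c P)) x0 x ->
    disagreement P (x t) @[t --> +oo] --> (0 : R).
  apply: (quad_form_solution_decay a_gt0) => v; have [// X_ge0 C_ge0] := dissip v.
  by apply: le_trans; rewrite lerDl.
split=> [x0 x /decay|x0]; first exact: consensus_of_disagreement_cvg b_gt0 bP.
split=> [|lt_gamma x xsol]; first by rewrite disagreementE.
apply: (@le_lt_trans _ _ (disagreement P x0)%:E); last by rewrite lte_fin.
apply: integral_quad_form_le xsol (decay _ _ xsol) => v.
have [X_ge0 C_ge0 VC] := dissip v; rewrite C_ge0 /=.
rewrite -subr_le0 opprK addrC; apply: le_trans VC _.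
by rewrite mulNr oppr_le0 mulr_ge0// ltW.
Qed.

Theorem theorem14 (R : realType) (N n m : nat) (hN : (2 <= N)%N)
    (A : 'M[R]_n) (B : 'M[R]_(n, m)) (hAB : stabilizable A B)
    (Q : 'M[R]_n) (hQ : pos_semidef Q)
    (Rw : 'M[R]_m) (hRw : pos_def Rw)
    (e : rel 'I_N) (he : undirected_graph e) (hconn : connected_graph e)
    (lam : N.-tuple R) (hlam : ordered_eigenvalues (laplacian R e) lam)
    (hlam1 : lam`_0 = 0) (hlam2 : 0 < lam`_1)
    (l2 LN : R) (hl2 : 0 < l2) (hl2_le : l2 <= lam`_1)
    (hLN : lam`_N.-1 <= LN)
    (gamma : R) (hgamma : 0 < gamma) :
  (forall (c : R) (P : 'M[R]_n),
     2 / (l2 + LN) <= c -> c < 2 / LN ->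
     pos_semidef P ->
     neg_def (riccati_expr A B Q Rw LN c LN P) ->
     reaches_consensus e A B (gain B Rw c P) /\
     forall x0 : 'cV[R]_(N * n),
       (disagreement P x0 < gamma <-> pairwise_disagreement P x0 < gamma) /\
       (disagreement P x0 < gamma ->
        suboptimal e A B Q Rw gamma (gain B Rw c P) x0))
  /\
  (forall (c : R) (P : 'M[R]_n),
     0 < c -> c < 2 / (l2 + LN) ->
     pos_semidef P ->
     neg_def (riccati_expr A B Q Rw LN c l2 P) ->
     reaches_consensus e A B (gain B Rw c P) /\
     forall x0 : 'cV[R]_(N * n),
       (disagreement P x0 < gamma <-> pairwise_disagreement P x0 < gamma) /\
       (disagreement P x0 < gamma ->
        suboptimal e A B Q Rw gamma (gain B Rw c P) x0)).
Proof.
have N_gt0 : (0 < N)%N := ltnW hN.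
have lam1N : lam`_1 <= lam`_N.-1.
  case: hlam => _ lam_sorted.
  by apply: (le_sorted_leq_nth _ lam_sorted);
    rewrite ?inE ?size_tuple ?prednK// -ltnS prednK.
have LN_gt0 : 0 < LN by exact: lt_le_trans hlam2 (le_trans lam1N hLN).
have l2LN_gt0 : 0 < l2 + LN by rewrite addr_gt0.
have parabola (c s d : R) : c ^+ 2 * s ^+ 2 - 2 * c * s
    - (c ^+ 2 * d ^+ 2 - 2 * c * d) = c * ((s - d) * (c * (s + d) - 2)).
  by ring.
split=> c P.
- rewrite ler_pdivrMr// => c_ge _; have c_gt0 : 0 < c.
    by rewrite -(pmulr_lgt0 _ l2LN_gt0) (lt_le_trans _ c_ge).
  apply: (consensus_and_suboptimal _ _ _ _ _ _ hlam _ _ _ hLN) => //; first exact: ltW.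
  move=> d /andP[d_ge d_le]; rewrite -subr_ge0 parabola.
  apply: (mulr_ge0 (ltW c_gt0)); apply: mulr_ge0; rewrite subr_ge0.
    exact: le_trans d_le hLN.
  apply: le_trans c_ge _; rewrite ler_wpM2l ?(ltW c_gt0)// addrC lerD2l.
  exact: le_trans hl2_le d_ge.
- rewrite ltr_pdivlMr// => c_gt0 c_lt.
  apply: (consensus_and_suboptimal _ _ _ _ _ _ hlam _ _ _ hLN) => //; first exact: ltW.
  move=> d /andP[d_ge d_le]; rewrite -subr_ge0 parabola.
  apply: (mulr_ge0 (ltW c_gt0)); apply: mulr_le0; rewrite subr_le0.
    exact: le_trans hl2_le d_ge.
  apply: le_trans (ltW c_lt); rewrite ler_wpM2l ?(ltW c_gt0)// lerD2l.
  exact: le_trans d_le hLN.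
Qed.
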